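(* Let $G$ be a finite simple graph with vertex set $\{t_1,\ldots,t_s\}$, $s\geq1$, let $i(G)$ be its independent domination number, let $W_G$ be its whisker graph, let $K$ be a field, and let $I(W_G)\subset K[V(W_G)]$ be the edge ideal of $W_G$. Then (a) $\mathrm{v}(I(W_G))=i(G)$, and (b) $\mathrm{v}(I(W_G))\leq\mathrm{reg}(K[V(W_G)]/I(W_G))$.
   Context: The whisker graph $W_G$ is obtained from $G$ by adding new vertices $u_1,\ldots,u_s$ and new edges $\{t_i,u_i\}$, $i=1,\ldots,s$, so $V(W_G)=\{t_1,\ldots,t_s,u_1,\ldots,u_s\}$. The independent domination number $i(G)$ is the minimum cardinality of a maximal (with respect to inclusion) stable set of $G$, where a stable set is a set of pairwise non-adjacent vertices. The edge ideal of a graph $H$ is the ideal of $S=K[V(H)]$ (vertices are variables) generated by all products $xy$ with $\{x,y\}\in E(H)$. With the standard grading $S=\bigoplus_{d\ge0}S_d$, and for an ideal $I\subsetneq\mathfrak{m}$, where $\mathfrak{m}$ is the ideal generated by all variables, the v-number is $\mathrm{v}(I)=\min\{d\geq 1\mid \exists f\in S_d\text{ and }\mathfrak{p}\in\mathrm{Ass}(I)\text{ with }(I\colon f)=\mathfrak{p}\}$, where $\mathrm{Ass}(I)$ is the set of associated primes of $S/I$ and $(I\colon f)=\{g\in S\mid gf\in I\}$. The regularity of $S/I$ is $\mathrm{reg}(S/I)=\max\{j-i\mid b_{i,j}\neq0\}$, where $b_{i,j}$ are the graded Betti numbers of the minimal graded free resolution of $S/I$ over $S$. *)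

(* Defs.v *)
From mathcomp Require Import all_boot all_order all_algebra.
From mathcomp Require Import mpoly.

Set Implicit Arguments.
Unset Strict Implicit.
Unset Printing Implicit Defensive.

Import Order.TTheory GRing.Theory Num.Theory.
Local Open Scope ring_scope.

(** Graphs: symmetric irreflexive relations on a finite type *)

Definition stable_set (T : finType) (e : rel T) (A : {set T}) : bool :=
  [forall x in A, forall y in A, ~~ e x y].

(* The default value #|T| of the iterated minimum is harmless: a maximal
   stable set exists, and no subset of T has more than #|T| elements. *)
Definition indep_domination (T : finType) (e : rel T) : nat :=
  \big[minn/#|T|]_(A : {set T} | maxset (stable_set e) A) #|A|.

(* For i : 'I_s, t_i is [lshift s i] and u_i is [rshift s i]. *)
Definition whisker (s : nat) (e : rel 'I_s) : rel 'I_(s + s) :=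
  fun x y =>
    match split x, split y with
    | inl i, inl j => e i j
    | inl i, inr j | inr i, inl j => i == j
    | inr _, inr _ => false
    end.

(** Ideals, as Prop-valued predicates *)

Section Ideals.
Variable R : comNzRingType.
Implicit Types (I P G : R -> Prop) (f : R).

Definition is_ideal I : Prop :=
  [/\ I 0, forall f g, I f -> I g -> I (f + g) & forall f g, I g -> I (f * g)].

Definition is_prime_ideal P : Prop :=
  [/\ is_ideal P, ~ P 1 & forall f g, P (f * g) -> P f \/ P g].

Definition ideal_span G : R -> Prop := fun f =>
  exists l : seq (R * R),
    (forall p, p \in l -> G p.2) /\ f = \sum_(p <- l) p.1 * p.2.

Definition colon I f : R -> Prop := fun g => I (g * f).

(* (I : f) is the annihilator of the class of f in R/I. *)
Definition assoc_prime I P : Prop :=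
  is_prime_ideal P /\ exists f, forall g, colon I f g <-> P g.

End Ideals.

Section PolynomialIdeals.
Variables (n : nat) (K : fieldType).
Local Notation S := {mpoly K[n]}.
Implicit Types I : S -> Prop.

Definition irrelevant_ideal : S -> Prop :=
  ideal_span (fun f => exists i : 'I_n, f = 'X_i).

Definition edge_ideal (e : rel 'I_n) : S -> Prop :=
  ideal_span (fun f => exists i j : 'I_n, e i j /\ f = 'X_i * 'X_j).

Definition v_degree I (d : nat) : Prop :=
  (1 <= d)%N /\
  exists (f : S) (P : S -> Prop),
    [/\ f \is d.-homog, assoc_prime I P & forall g, colon I f g <-> P g].

Definition is_v_number I (v : nat) : Prop :=
  v_degree I v /\ forall d, v_degree I d -> (v <= d)%N.

(* The entry of a degree-preserving map S(-a) -> S(-b): zero or homogeneous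
   of degree a - b. *)
Definition homog_entry (f : S) (a b : int) : Prop :=
  f != 0 -> exists2 d : nat, f \is d.-homog & a = b + d%:Z.

(* A minimal graded free resolution
     ... -> F_2 -> F_1 -> F_0 -> S/I -> 0,
   where F_i is the direct sum of the S(- shift i a), a < rk i.  Elements of
   F_i are row vectors; [diff i] is the matrix of F_(i+1) -> F_i, acting by
   right multiplication; [aug] lists representatives in S of the images in
   S/I of the basis of F_0. *)
Record min_free_res I : Type := MinFreeRes {
  rk : nat -> nat;
  shift : forall i, 'I_(rk i) -> int;
  diff : forall i, 'M[S]_(rk i.+1, rk i);
  aug : 'cV[S]_(rk 0);
  diff_homog : forall i a b, homog_entry (diff i a b) (shift a) (shift b);
  aug_homog : forall a, homog_entry (aug a 0) (shift a) 0;
  aug_surj : forall f : S,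
    exists x : 'rV[S]_(rk 0), I ((x *m aug) 0 0 - f);
  aug_exact : forall x : 'rV[S]_(rk 0),
    I ((x *m aug) 0 0) <-> exists y : 'rV[S]_(rk 1), x = y *m diff 0;
  diff_exact : forall i (x : 'rV[S]_(rk i.+1)),
    x *m diff i = 0 <-> exists y : 'rV[S]_(rk i.+2), x = y *m diff i.+1;
  diff_minimal : forall i a b, irrelevant_ideal (diff i a b)
}.

Definition betti I (F : min_free_res I) (i : nat) (j : int) : nat :=
  #|[pred a : 'I_(rk F i) | shift a == j]|.

Definition is_regularity I (r : int) : Prop :=
  exists F : min_free_res I,
    (exists i j, betti F i j != 0%N /\ r = j - i%:Z) /\
    (forall i j, betti F i j != 0%N -> j - i%:Z <= r).

End PolynomialIdeals.

Arguments edge_ideal {n} K e _.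

(* Main.v *)
(* (a) If A is a maximal stable set of G and f is the product of the t_i, i in A,
   then (I : f) is generated by the t_j, j not in A, and the u_i, i in A; hence
   v <= i(G).  Conversely, if (I : f) is prime, a monomial of f outside I already
   involves t_i or u_i for each i in some maximal stable set, so deg f >= i(G).

   (b) For a stable set A of size d the edges {t_i, u_i}, i in A, form an induced
   matching.  Their monomials f_1, ..., f_d form a regular sequence, and so they
   do modulo the remaining t_j.  A generator of degree >= 2d in step d of the
   resolution F is found by iterated dimension shifting: lifting 1 along F gives
   z in F_d, and dividing the augmentation successively by the f_k gives a map
   G : F_d -> S of degree -2d with G(z) = 1 modulo the f_k and the t_j.  If all
   generators of F_d had degree < 2d, then G = 0 for degree reasons. *)
Require Import Defs.
From mathcomp Require Import all_boot all_order all_algebra.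
From mathcomp Require Import mpoly.

Set Implicit Arguments.
Unset Strict Implicit.
Unset Printing Implicit Defensive.

Import Order.TTheory GRing.Theory Num.Theory.
Local Open Scope ring_scope.

(** * Polynomials restricted by a predicate on their monomials *)

Section SupportPredicates.
Variables (n : nat) (R : nzRingType).
Implicit Types (P Q : pred 'X_{1..n}) (p q : {mpoly R[n]}).

Definition supp_in P p : bool := all P (msupp p).

Lemma supp_in0 P : supp_in P 0.
Proof. by rewrite /supp_in msupp0. Qed.

Lemma supp_inD P p q : supp_in P p -> supp_in P q -> supp_in P (p + q).
Proof.
move=> /allP hp /allP hq; apply/allP => m /msuppD_le.
by rewrite mem_cat => /orP[/hp|/hq].
Qed.

Lemma supp_inN P p : supp_in P (- p) = supp_in P p.
Proof. exact/perm_all/msuppN. Qed.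

Lemma supp_inB P p q : supp_in P p -> supp_in P q -> supp_in P (p - q).
Proof. by move=> hp hq; rewrite supp_inD ?supp_inN. Qed.

Lemma supp_in_sum P (T : Type) (r : seq T) (A : pred T) (f : T -> {mpoly R[n]}) :
  (forall i, A i -> supp_in P (f i)) -> supp_in P (\sum_(i <- r | A i) f i).
Proof.
by move=> h; apply: (big_ind (supp_in P)) => //; [exact: supp_in0|exact: supp_inD].
Qed.

Lemma supp_inM (P1 P2 P : pred 'X_{1..n}) p q :
  (forall m1 m2, P1 m1 -> P2 m2 -> P (m1 + m2)%MM) ->
  supp_in P1 p -> supp_in P2 q -> supp_in P (p * q).
Proof.
move=> h /allP hp /allP hq; apply/allP => m /msuppM_le /allpairsP[[m1 m2]] /=.
by case=> /hp h1 /hq h2 ->; apply: h.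
Qed.

Lemma supp_inZX P c m : P m -> supp_in P (c *: 'X_[m]).
Proof.
have [->|c0] := eqVneq c 0; first by rewrite scale0r supp_in0.
by move=> Pm; rewrite /supp_in msuppMCX //= Pm.
Qed.

(** The degree is an integer because it will be a difference of shifts; the zero polynomial has
    every degree, negative ones included. *)
Definition hdeg (D : int) p : bool := supp_in (fun m => (mdeg m)%:Z == D) p.

Lemma hdegM D1 D2 p q : hdeg D1 p -> hdeg D2 q -> hdeg (D1 + D2) (p * q).
Proof. by apply: supp_inM => m1 m2 /eqP <- /eqP <-; rewrite mdegD PoszD. Qed.

Lemma hdeg_lt0 D p : D < 0 -> hdeg D p -> p = 0.
Proof.
move=> D0; rewrite /hdeg /supp_in; case E: (msupp p) => [|m l].
  by move=> _; apply/eqP; rewrite -msupp_eq0 E.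
by case/andP=> /eqP DE; rewrite -DE in D0.
Qed.

End SupportPredicates.

(** * Monomial ideals and division by a monomial *)

Section MonomialIdeals.
Variables (n : nat) (K : fieldType).
Local Notation S := {mpoly K[n]}.
Implicit Types (L : seq 'X_{1..n}) (p q h : S) (f m : 'X_{1..n}).

Definition mdvd L m : bool := has (fun g => (g <= m)%MM) L.

(* Membership in the monomial ideal generated by L. *)
Definition in_mono L p : bool := supp_in (mdvd L) p.

Lemma mdvdD L m m' : mdvd L m -> mdvd L (m + m')%MM.
Proof.
case/hasP=> g gL le; apply/hasP; exists g => //.
exact: lepm_trans le (lem_addr _ _).
Qed.

Lemma in_monoMr L p q : in_mono L q -> in_mono L (p * q).
Proof.
move=> h; apply: (supp_inM (P1 := predT) _ _ h); last by apply/allP.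
by move=> m1 m2 _ h2; rewrite addmC; apply: mdvdD.
Qed.

Lemma in_mono_nil p : in_mono [::] p -> p = 0.
Proof.
rewrite /in_mono /supp_in; case E: (msupp p) => [|m l] //= _.
by apply/eqP; rewrite -msupp_eq0 E.
Qed.

Lemma in_mono_sub L L' p : {subset L <= L'} -> in_mono L p -> in_mono L' p.
Proof.
move=> sub; apply: sub_all => m /hasP[g gL le].
by apply/hasP; exists g => //; apply: sub.
Qed.

Lemma in_monoX L f : f \in L -> in_mono L 'X_[f].
Proof.
move=> fL; rewrite /in_mono /supp_in msuppX /= andbT.
by apply/hasP; exists f; rewrite ?lepm_refl.
Qed.

Definition mcoprime f m : bool := [forall i, (f i == 0%N) || (m i == 0%N)].

Lemma mcoprimeC f m : mcoprime f m = mcoprime m f.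
Proof. by apply: eq_forallb => i; rewrite orbC. Qed.

Lemma in_monoXM L m p : in_mono L ('X_[m] * p) = supp_in (fun k => mdvd L (m + k)%MM) p.
Proof. by rewrite mulrC /in_mono /supp_in (perm_all _ (msuppMX _ _)) all_map. Qed.

(** A generator sharing no variable with [f] that divides [f + m] already divides [m]. *)
Lemma in_mono_regular L f p :
  all (mcoprime f) L -> in_mono L ('X_[f] * p) -> in_mono L p.
Proof.
move=> /allP cop; rewrite in_monoXM; apply: sub_all => m /= /hasP[g gL /mnm_lepP le].
apply/hasP; exists g => //.
apply/mnm_lepP => i; have := le i; rewrite mnmDE.
by have /forallP/(_ i)/orP[/eqP->|/eqP->] := cop _ gL.
Qed.

(* The quotient of p by X^f modulo the monomial ideal generated by L. *)
Definition mono_quo L f p : S :=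
  \sum_(m <- msupp p | ~~ mdvd L m) p@_m *: 'X_[m - f].

Lemma mono_quo_rem L f p :
  in_mono (f :: L) p -> in_mono L (p - 'X_[f] * mono_quo L f p).
Proof.
move=> /allP hp; have quoE : 'X_[f] * mono_quo L f p =
    \sum_(m <- msupp p | ~~ mdvd L m) p@_m *: 'X_[m].
  rewrite mulr_sumr [LHS]big_seq_cond [RHS]big_seq_cond; apply: eq_bigr => m.
  case/andP=> /hp /= /orP[le _|-> //].
  by rewrite -scalerAr -mpolyXD addmC submK.
rewrite quoE {1}[p]mpolyE (bigID (mdvd L)) /= addrK.
by apply: supp_in_sum => m; apply: supp_inZX.
Qed.

Lemma hdeg_mono_quo L f p (D : int) :
  in_mono (f :: L) p -> hdeg D p -> hdeg (D - (mdeg f)%:Z) (mono_quo L f p).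
Proof.
move=> /allP hp /allP dp; rewrite /mono_quo big_seq_cond; apply: supp_in_sum => m.
case/andP=> mp /negbTE nL; apply: supp_inZX; have := hp _ mp.
rewrite /= nL orbF => le; rewrite -(eqP (dp _ mp)) -{2}(submK le) mdegD PoszD.
by rewrite addrK.
Qed.

Definition mono_mx L r c (M : 'M[S]_(r, c)) : Prop := forall i j, in_mono L (M i j).

Lemma mono_mx0 L r c : mono_mx L (0 : 'M_(r, c)).
Proof. by move=> i j; rewrite mxE; apply: supp_in0. Qed.

Lemma mono_mx_opp L r c (M : 'M_(r, c)) : mono_mx L (- M) -> mono_mx L M.
Proof. by move=> hM i j; have := hM i j; rewrite mxE /in_mono supp_inN. Qed.

Lemma mono_mxD L r c (M N : 'M_(r, c)) :
  mono_mx L M -> mono_mx L N -> mono_mx L (M + N).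
Proof. by move=> hM hN i j; rewrite mxE; apply: supp_inD; [apply: hM|apply: hN]. Qed.

Lemma mono_mxB L r c (M N : 'M_(r, c)) :
  mono_mx L M -> mono_mx L N -> mono_mx L (M - N).
Proof. by move=> hM hN i j; rewrite !mxE; apply: supp_inB; [apply: hM|apply: hN]. Qed.

Lemma mono_mxZ L r c p (M : 'M_(r, c)) : mono_mx L M -> mono_mx L (p *: M).
Proof. by move=> hM i j; rewrite !mxE; apply/in_monoMr/hM. Qed.

Lemma mono_mxMl L r c d (N : 'M_(r, c)) (M : 'M_(c, d)) :
  mono_mx L M -> mono_mx L (N *m M).
Proof. by move=> hM i j; rewrite mxE; apply: supp_in_sum => k _; apply/in_monoMr/hM. Qed.

Lemma mono_mxMr L r c d (M : 'M_(r, c)) (N : 'M_(c, d)) :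
  mono_mx L M -> mono_mx L (M *m N).
Proof.
by move=> hM i j; rewrite mxE; apply: supp_in_sum => k _; rewrite mulrC; apply/in_monoMr/hM.
Qed.

Lemma mono_mx_sub L L' r c (M : 'M_(r, c)) :
  {subset L <= L'} -> mono_mx L M -> mono_mx L' M.
Proof. by move=> sub hM i j; apply: in_mono_sub (hM i j). Qed.

Lemma mono_mx_regular L f r c (M : 'M_(r, c)) :
  all (mcoprime f) L -> mono_mx L ('X_[f] *: M) -> mono_mx L M.
Proof. by move=> cop hM i j; apply: (in_mono_regular cop); have := hM i j; rewrite mxE. Qed.

Lemma mono_mx_quo L f r c (M : 'M_(r, c)) :
  mono_mx (f :: L) M -> mono_mx L (M - 'X_[f] *: map_mx (mono_quo L f) M).
Proof. by move=> hM i j; rewrite !mxE; apply/mono_quo_rem/hM. Qed.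

Lemma mono_mxZX L f r c (M : 'M_(r, c)) : f \in L -> mono_mx L ('X_[f] *: M).
Proof. by move=> fL i j; rewrite mxE mulrC; apply: in_monoMr; apply: in_monoX. Qed.

End MonomialIdeals.

(** * Free resolutions modulo regular sequences of monomials *)

Section Resolutions.
Variables (n : nat) (K : fieldType) (I : {mpoly K[n]} -> Prop).
Variable F : min_free_res I.
Implicit Types (fs J B L : seq 'X_{1..n}).
Local Notation d := (diff F).

Lemma diff_comp i : d i.+1 *m d i = 0.
Proof.
apply/row_matrixP => a; rewrite row0 row_mul.
by apply/(diff_exact (i := i)); exists (delta_mx 0 a); rewrite rowE.
Qed.

(* Tor_i(S/I, S/(J)) = 0 for i > size J, since J is a regular sequence. *)
Lemma exact_mod_regular J i (x : 'rV_(rk F i.+1)) :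
  pairwise (@mcoprime n) J -> (size J <= i)%N -> mono_mx J (x *m d i) ->
  exists y, mono_mx J (x - y *m d i.+1).
Proof.
elim/last_ind: J i x => [|J f IH] i x.
  move=> _ _ hx; have /(diff_exact (i := i))[y ->] : x *m d i = 0.
    by apply/matrixP => a b; rewrite [RHS]mxE; apply: in_mono_nil.
  by exists y; rewrite subrr; apply: mono_mx0.
rewrite pairwise_rcons size_rcons => /andP[cop pJ].
have {}cop : all (mcoprime f) J by apply: sub_all cop => m; rewrite mcoprimeC.
case: i x => [//|i] x; rewrite ltnS => Ji hx.
have sub : {subset J <= rcons J f} by move=> m mJ; rewrite mem_rcons inE mJ orbT.
have {}hx : mono_mx (f :: J) (x *m d i.+1).
  by apply: mono_mx_sub hx => m; rewrite mem_rcons.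
(* Modulo [J], [x *m d i.+1] is [f] times [w], and cancelling [f] makes [w] a cycle. By induction
   [w] is a boundary [y *m d i.+1], so [x - f y] is a cycle modulo [J], and induction applies again
   one step higher. *)
set w := map_mx (mono_quo J f) (x *m d i.+1).
have hw : mono_mx J (x *m d i.+1 - 'X_[f] *: w) := mono_mx_quo hx.
have /IH[||y hy] // : mono_mx J (w *m d i).
  apply: (mono_mx_regular cop); have := mono_mxMr (d i) hw.
  by rewrite mulmxBl -mulmxA diff_comp mulmx0 sub0r -scalemxAl => /mono_mx_opp.
have /IH[||y' hy'] // : mono_mx J ((x - 'X_[f] *: y) *m d i.+1).
  rewrite mulmxBl -scalemxAl.
  have -> : x *m d i.+1 - 'X_[f] *: (y *m d i.+1) =
     (x *m d i.+1 - 'X_[f] *: w) + 'X_[f] *: (w - y *m d i.+1).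
    by rewrite scalerBr addrA subrK.
  by apply: mono_mxD => //; apply: mono_mxZ.
  exact: leqW.
exists y'.
have -> : x - y' *m d i.+2 = (x - 'X_[f] *: y - y' *m d i.+2) + 'X_[f] *: y.
  by rewrite [x - _ - _]addrAC subrK.
apply: mono_mxD; first exact: mono_mx_sub hy'.
by apply: mono_mxZX; rewrite mem_rcons mem_head.
Qed.

Lemma hdeg_diff i a b : hdeg (shift a - shift b) (d i a b).
Proof.
have [->|nz] := eqVneq (d i a b) 0; first exact: supp_in0.
have [D /dhomogP hD ->] := @diff_homog _ _ _ F i a b nz.
by apply/allP => m /hD <-; rewrite addrAC subrr add0r.
Qed.

Lemma hdeg_aug a : hdeg (shift a) (aug F a 0).
Proof.
have [->|nz] := eqVneq (aug F a 0) 0; first exact: supp_in0.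
have [D /dhomogP hD ->] := @aug_homog _ _ _ F a nz.
by apply/allP => m /hD <-; rewrite add0r.
Qed.

Hypothesis idealI : is_ideal I.

(* z represents a class of Tor_k(S/I, S/(J)), k = size J, obtained from 1 by
   lifting through k connecting maps: f z_k = z_(k+1) d_k modulo the earlier
   elements of J, where f is the next one.  Dually G is obtained from the
   augmentation by d_k G_k = f G_(k+1) modulo the later elements and L.  These
   two recursions make the pairing z G independent of k modulo J ++ B ++ L. *)
Lemma koszul_pairing L J B :
  (forall p, I p -> in_mono (J ++ B ++ L) p) ->
  (forall f, f \in J ++ B -> I 'X_[f]) ->
  pairwise (@mcoprime n) (J ++ B) -> allrel (@mcoprime n) (J ++ B) L ->
  exists (z : 'rV_(rk F (size J))) (G : 'cV_(rk F (size J))),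
  [/\ forall g, I g -> exists y, mono_mx J (g *: z - y *m d (size J)),
      mono_mx (B ++ L) (d (size J) *m G),
      forall a, hdeg (shift a - (\sum_(f <- J) mdeg f)%N%:Z) (G a 0) &
      mono_mx (J ++ B ++ L) (z *m G - 1%:M)].
Proof.
case: idealI => I0 ID IM IL.
elim/last_ind: J B IL => [|J f IH] B IL Ifs pw cop.
  have [z hz] := @aug_surj _ _ _ F 1; exists z, (aug F); split => /=.
  - move=> g Ig; suff /aug_exact[y ->] : I (((g *: z) *m aug F) 0 0).
      by exists y; rewrite subrr; apply: mono_mx0.
    have -> : ((g *: z) *m aug F) 0 0 =
        g * ((z *m aug F) 0 0 - 1) + 1 * g.
      by rewrite -scalemxAl mxE mulrBr mulr1 mul1r subrK.
    by apply: ID; apply: IM.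
  - move=> a b; rewrite (ord1 b); apply: IL.
    have -> : (d 0 *m aug F) a 0 = (((delta_mx 0 a : 'rV_(rk F 0.+1)) *m d 0) *m aug F) 0 0.
      by rewrite -mulmxA -rowE [RHS]mxE.
    by apply/aug_exact; exists (delta_mx 0 a).
  - by move=> a; rewrite big_nil subr0 hdeg_aug.
  - by move=> a b; rewrite !ord1; have := IL _ hz; rewrite !mxE.
move: IL Ifs pw cop; rewrite !cat_rcons => IL Ifs pw cop.
(* With [f] at the head of [B], the image of [G] under the differential lies in the ideal of
   [f :: B ++ L], hence can be divided by [f] modulo [B ++ L]. *)
have [//|//|//|//|z [G [hz hG dG hzG]]] := IH (f :: B).
have If : I 'X_[f] by apply: Ifs; rewrite mem_cat mem_head orbT.
have [z' hz'] := hz _ If.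
rewrite size_rcons; set k := size J in z G hz hG dG hzG z' hz' *.
pose G' := map_mx (mono_quo (B ++ L) f) (d k *m G).
have hG' : mono_mx (B ++ L) (d k *m G - 'X_[f] *: G') := mono_mx_quo hG.
move: (pw); rewrite pairwise_cat allrel_consr /= => /and4P[/andP[fJ _] pJ fB pB].
have {}fJ : all (mcoprime f) J by apply: sub_all fJ => m; rewrite mcoprimeC.
have fL : all (mcoprime f) L.
  by move: cop; rewrite allrel_catl allrel_consl => /and3P[].
exists z', G'; split.
- move=> g Ig; have [y hy] := hz _ Ig.
  (* The terms [f g z] cancel in the image under [d k], so this difference is a cycle modulo [J]. *)
  have [//|//||y' hy'] := @exact_mod_regular J k (g *: z' - 'X_[f] *: y).
    have -> : (g *: z' - 'X_[f] *: y) *m d k =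
       'X_[f] *: (g *: z - y *m d k) - g *: ('X_[f] *: z - z' *m d k).
      rewrite mulmxBl -!scalemxAl !scalerBr !scalerA [g * _]mulrC.
      by rewrite opprB [RHS]addrC addrA subrK.
    by apply: mono_mxB; apply: mono_mxZ.
  exists y'; have -> : g *: z' - y' *m d k.+1 =
    (g *: z' - 'X_[f] *: y - y' *m d k.+1) + 'X_[f] *: y.
    by rewrite [_ *: z' - _ - _]addrAC subrK.
  apply: mono_mxD; last by apply: mono_mxZX; rewrite mem_rcons mem_head.
  by apply: mono_mx_sub hy' => m mJ; rewrite mem_rcons inE mJ orbT.
- apply: (@mono_mx_regular _ _ _ f); first by rewrite all_cat fB.
  have := mono_mxMl (d k.+1) hG'; rewrite mulmxBr mulmxA diff_comp mul0mx sub0r.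
  by rewrite -scalemxAr => /mono_mx_opp.
- move=> a; rewrite mxE.
  rewrite -cats1 big_cat big_seq1 /= PoszD opprD addrA.
  apply: hdeg_mono_quo; first exact: hG.
  rewrite mxE; apply: supp_in_sum => b _.
  by rewrite -[shift a](subrK (shift b)) -addrA; apply: hdegM (hdeg_diff _ _) (dG b).
(* The pairing is unchanged: [f] times the difference telescopes through [z' *m d k *m G], and [f]
   is regular modulo [J ++ B ++ L]. *)
suff h : mono_mx (J ++ B ++ L) (z *m G - z' *m G').
  have -> : z' *m G' - 1%:M = (z *m G - 1%:M) - (z *m G - z' *m G').
    by rewrite opprB [RHS]addrC addrA subrK.
  apply: mono_mxB => //; apply: mono_mx_sub h => m.
  by rewrite !(mem_cat, inE) => /or3P[] ->; rewrite ?orbT.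
apply: (@mono_mx_regular _ _ _ f); first by rewrite !all_cat fJ fB.
have -> : 'X_[f] *: (z *m G - z' *m G') =
   ('X_[f] *: z - z' *m d k) *m G + z' *m (d k *m G - 'X_[f] *: G').
  by rewrite mulmxBl mulmxBr mulmxA addrA subrK -scalemxAl -scalemxAr scalerBr.
apply: mono_mxD; [apply: mono_mxMr|apply: mono_mxMl].
  by apply: mono_mx_sub hz' => m mJ; rewrite mem_cat mJ.
by apply: mono_mx_sub hG' => m mJ; rewrite mem_cat mJ orbT.
Qed.

Lemma shift_lower_bound fs L :
  (forall p, I p -> in_mono (fs ++ L) p) -> (forall f, f \in fs -> I 'X_[f]) ->
  pairwise (@mcoprime n) fs -> allrel (@mcoprime n) fs L ->
  0%MM \notin fs ++ L ->
  exists a : 'I_(rk F (size fs)), (\sum_(f <- fs) mdeg f)%N%:Z <= shift a.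
Proof.
move=> IL Ifs pw cop nz.
have [||||z [G [_ _ dG hzG]]] := @koszul_pairing L fs [::]; rewrite ?cats0 //.
have [/existsP[a ha]|/existsPn h] := boolP [exists a : 'I_(rk F (size fs)),
  (\sum_(f <- fs) mdeg f)%N%:Z <= shift a]; first by exists a.
have G0 : G = 0.
  apply/matrixP => a b; rewrite (ord1 b) mxE; apply: hdeg_lt0 (dG a).
  by rewrite subr_lt0 ltNge h.
(* With [G = 0] the pairing puts 1 in the ideal of [fs ++ L], so a generator divides 1 and must be
   the trivial monomial. *)
have := hzG 0 0; rewrite G0 mulmx0 !mxE sub0r eqxx /in_mono supp_inN /supp_in.
rewrite msupp1 /= andbT => /hasP[m mL /mnm_lepP le].
by case/negP: nz; suff <- : m = 0%MM by []; apply/mnmP => i; rewrite mnm0E;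
  apply/eqP; rewrite -leqn0; have := le i; rewrite mnm0E.
Qed.

End Resolutions.

(** * Edge ideals and primes generated by variables *)

Section EdgeIdeals.
Variables (n : nat) (K : fieldType).
Local Notation S := {mpoly K[n]}.
Implicit Types (e : rel 'I_n) (p q : S) (V : pred 'I_n) (m : 'X_{1..n}).

Definition edge_mnms e : seq 'X_{1..n} :=
  [seq (U_(x.1) + U_(x.2))%MM | x <- enum [pred x | e x.1 x.2]].

Lemma mem_edge_mnms e i j : e i j -> (U_(i) + U_(j))%MM \in edge_mnms e.
Proof. by move=> eij; apply/mapP; exists (i, j); rewrite ?mem_enum. Qed.

Lemma edge_idealP e p : edge_ideal K e p <-> in_mono (edge_mnms e) p.
Proof.
split=> [[l [hl ->]]|/allP hp].
  rewrite big_seq; apply: supp_in_sum => x /hl[i [j [eij ->]]].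
  by apply: in_monoMr; rewrite -mpolyXD; apply/in_monoX/mem_edge_mnms.
rewrite [p]mpolyE big_seq.
apply: (big_ind (edge_ideal K e)) => [|_ _ [l1 [h1 ->]] [l2 [h2 ->]]|m mp].
- by exists [::]; rewrite big_nil.
- exists (l1 ++ l2); rewrite big_cat; split=> // x.
  by rewrite mem_cat => /orP[/h1|/h2].
have /hasP[_ /mapP[[i j] eij ->] le] := hp _ mp.
exists [:: (p@_m *: 'X_[m - (U_(i) + U_(j))], 'X_i * 'X_j)]; split.
  move=> x; rewrite inE => /eqP-> /=; exists i, j; split=> //.
  by move: eij; rewrite mem_enum.
by rewrite big_seq1 /= -mpolyXD -scalerAl -mpolyXD submK.
Qed.

(** Without loops the edge monomials are squarefree, so only the vanishing of exponents matters. *)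
Lemma mdvd_edgeP e m : irreflexive e ->
  reflect (exists i j, [/\ e i j, m i != 0%N & m j != 0%N])
          (mdvd (edge_mnms e) m).
Proof.
move=> irr; apply: (iffP hasP) => [[_ /mapP[[i j] eij ->] /mnm_lepP le]|].
  move: eij le; rewrite mem_enum inE /= => eij le; exists i, j; split=> //.
    by have := le i; rewrite mnmDE mnm1E eqxx; case: (m i).
  by have := le j; rewrite mnmDE !mnm1E eqxx addn1; case: (m j).
case=> i [j [eij mi mj]]; exists (U_(i) + U_(j))%MM; first exact: mem_edge_mnms.
apply/mnm_lepP => k; rewrite mnmDE !mnm1E.
case: (eqVneq i k) => [ik|_]; case: (eqVneq j k) => [jk|_] //; subst;
  by rewrite ?irr ?addn0 ?lt0n // in eij *.
Qed.

Definition var_dvd V m : bool := [exists i, V i && (m i != 0%N)].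

(* A monomial ideal generated by variables is the kernel of the evaluation
   sending those variables to 0. *)
Lemma supp_in_var_dvdE V p : supp_in (var_dvd V) p =
  (p \mPo [tuple if V i then 0 else 'X_i | i < n] == 0).
Proof.
set lq := [tuple _ | i < n].
have lqX m : 'X_[m] \mPo lq = if var_dvd V m then 0 else 'X_[K, m].
  rewrite comp_mpolyX; case: ifP => [/existsP[i /andP[Vi mi]]|/existsP h].
    by rewrite (bigD1 i) //= tnth_mktuple Vi expr0n (negbTE mi) mul0r.
  rewrite mpolyXE_id; apply: eq_bigr => i _; rewrite tnth_mktuple.
  case: ifP => // Vi; have [->|mi] := eqVneq (m i) 0%N; first by rewrite !expr0.
  by case: h; exists i; rewrite Vi mi.
have -> : p \mPo lq = \sum_(m <- msupp p | ~~ var_dvd V m) p@_m *: 'X_[m].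
  rewrite {1}[p]mpolyE linear_sum [RHS]big_mkcond /=; apply: eq_bigr => m _.
  by rewrite linearZ /= lqX; case: ifP; rewrite ?scaler0.
rewrite -big_filter -msupp_eq0; set r := [seq m <- _ | _].
have /perm_size rE : perm_eq (msupp (\sum_(m <- r) p@_m *: 'X_[m])) r.
  apply: msupp_sumX; first by rewrite filter_uniq ?msupp_uniq.
  by move=> m; rewrite mem_filter -mcoeff_msupp => /andP[].
by rewrite -size_eq0 rE size_eq0 -[_ == _]negbK -has_filter has_predC negbK.
Qed.

(** The ideal is the kernel of an evaluation into an integral domain. *)
Lemma prime_var_dvd V : is_prime_ideal (fun p => supp_in (var_dvd V) p).
Proof.
split.
- split=> [|p q|p q]; first exact: supp_in0.
    exact: supp_inD.
  by rewrite !supp_in_var_dvdE rmorphM /= => /eqP->; rewrite mulr0.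
- by rewrite supp_in_var_dvdE rmorph1 oner_eq0.
by move=> p q; rewrite !supp_in_var_dvdE rmorphM mulf_eq0 => /orP.
Qed.

End EdgeIdeals.

(** * Maximal stable sets *)

Section IndependentDomination.
Variables (T : finType) (e : rel T).
Implicit Types A : {set T}.

Lemma stable_setP A : reflect {in A &, forall x y, ~~ e x y} (stable_set e A).
Proof.
apply: (iffP forall_inP) => h x; last by move=> xA; apply/forall_inP => y; apply: h.
by move=> y xA yA; have /forall_inP := h _ xA; apply.
Qed.

Lemma indep_domination_le A : maxset (stable_set e) A -> (indep_domination e <= #|A|)%N.
Proof.
by move=> mA; rewrite /indep_domination -minEnat -leEnat; apply: bigmin_le_cond.
Qed.

Lemma indep_domination_eq :
  exists2 A, maxset (stable_set e) A & indep_domination e = #|A|.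
Proof.
have s0 : stable_set e set0 by apply/stable_setP => x; rewrite inE.
have [A0 mA0 _] := maxset_exists s0.
have : indep_domination e = #|T| \/
  exists2 A, maxset (stable_set e) A & indep_domination e = #|A|.
  apply: (big_ind (fun k => k = #|T| \/
     exists2 A, maxset (stable_set e) A & k = #|A|)) => [|k l hk hl|A mA].
  - by left.
  - by rewrite /minn; case: ifP.
  - by right; exists A.
(* If the minimum is the default [#|T|], then [A0] attains it, since its size lies between the
   minimum and [#|T|]. *)
case=> // eT; exists A0 => //; apply/eqP; rewrite eqn_leq indep_domination_le //=.
by rewrite eT max_card.
Qed.

Lemma maxset_stable_dominating A x :
  ssrbool.symmetric e -> irreflexive e -> maxset (stable_set e) A -> x \notin A ->
  exists2 y, y \in A & e x y.
Proof.
move=> sym irr /maxsetP[/stable_setP sA maxA] xA; apply/exists_inP.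
apply: contraNT xA => /exists_inPn h; rewrite -(maxA (x |: A)) ?setU11 ?subsetUr //.
apply/stable_setP => a b; rewrite !inE.
case/predU1P=> [->|aA] /predU1P[->|bA]; rewrite ?irr ?h //; last exact: sA.
by rewrite sym h.
Qed.

End IndependentDomination.

(** * Whisker graphs: colon ideals and shifts *)

Section WhiskerGraph.
Variables (s : nat) (e : rel 'I_s) (K : fieldType).
Hypotheses (e_sym : ssrbool.symmetric e) (e_irr : irreflexive e).
Local Notation t := (lshift s).
Local Notation u := (@rshift s s).
Local Notation I := (edge_ideal K (whisker e)).
Local Notation E := (edge_mnms (whisker e)).
Implicit Types (A : {set 'I_s}) (m : 'X_{1..s + s}).

Lemma split_lshift (i : 'I_s) : split (t i) = inl i.
Proof. exact: (unsplitK (inl i)). Qed.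

Lemma split_rshift (i : 'I_s) : split (u i) = inr i.
Proof. exact: (unsplitK (inr i)). Qed.

Lemma whisker_tt i j : whisker e (t i) (t j) = e i j.
Proof. by rewrite /whisker !split_lshift. Qed.

Lemma whisker_tu i j : whisker e (t i) (u j) = (i == j).
Proof. by rewrite /whisker split_lshift split_rshift. Qed.

Lemma whisker_irr : irreflexive (whisker e).
Proof. by move=> x; rewrite /whisker; case: (split x). Qed.

Lemma mdvd_whiskerP m :
  reflect ((exists i j, [/\ e i j, m (t i) != 0%N & m (t j) != 0%N]) \/
           (exists2 i, m (t i) != 0%N & m (u i) != 0%N))
          (mdvd E m).
Proof.
apply: (iffP (mdvd_edgeP _ whisker_irr)) => [[x [y [+ mx my]]]|].
  case: (split_ordP x) mx => i -> mi; case: (split_ordP y) my => j -> mj.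
  - by rewrite whisker_tt => eij; left; exists i, j.
  - by rewrite whisker_tu => /eqP ij; subst; right; exists j.
  - by rewrite /whisker split_lshift split_rshift => /eqP ij; subst; right; exists j.
  - by rewrite /whisker !split_rshift.
case=> [[i [j [eij mi mj]]]|[i mi mj]].
  by exists (t i), (t j); rewrite whisker_tt.
by exists (t i), (u i); rewrite whisker_tu.
Qed.

Definition set_mnm A : 'X_{1..s + s} := [multinom ((x \in t @: A) : nat) | x < s + s].

Lemma set_mnm_t A i : set_mnm A (t i) = (i \in A).
Proof. by rewrite mnmE (mem_imset _ _ (@lshift_inj _ _)). Qed.

Lemma set_mnm_u A i : set_mnm A (u i) = 0%N.
Proof.
rewrite mnmE; case: imsetP => // -[j _ /(congr1 (@nat_of_ord _))] /= h.
by have := ltn_ord j; rewrite -h ltnNge leq_addr.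
Qed.

Lemma mdeg_set_mnm A : mdeg (set_mnm A) = #|A|.
Proof.
rewrite mdegE -(card_imset _ (@lshift_inj s s)) -sum1_card [RHS]big_mkcond.
by apply: eq_bigr => x _; rewrite mnmE; case: (x \in _).
Qed.

(* The variables generating the colon ideal of I by set_mnm A, for A a maximal
   stable set: a minimal vertex cover of the whisker graph. *)
Definition colon_vars A : pred 'I_(s + s) :=
  fun x => match split x with inl i => i \notin A | inr i => i \in A end.

(** Domination gives each [t_j] outside [A] a neighbour in [A], and [t_i] completes [u_i] to an edge
    for [i] in [A]. Conversely [A] is stable and [set_mnm A] has no [u_i], so any edge dividing the
    product takes a colon variable from [m]. *)
Lemma colon_set_mnm A m : maxset (stable_set e) A ->
  mdvd E (set_mnm A + m)%MM = var_dvd (colon_vars A) m.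
Proof.
move=> mA; have /maxsetP[/stable_setP sA _] := mA.
have dom i : i \notin A -> exists2 j, j \in A & e i j.
  exact: maxset_stable_dominating.
apply/mdvd_whiskerP/existsP => [[[i [j [eij]]]|[i]]|[x]].
- rewrite !mnmDE !set_mnm_t.
  have [iA|iA] := boolP (i \in A); last first.
    by move=> mi _; exists (t i); rewrite /colon_vars split_lshift iA.
  have [jA|jA] := boolP (j \in A); first by have := sA _ _ iA jA; rewrite eij.
  by move=> _ mj; exists (t j); rewrite /colon_vars split_lshift jA.
- rewrite !mnmDE set_mnm_t set_mnm_u; have [iA|iA] := boolP (i \in A) => mi mj.
    by exists (u i); rewrite /colon_vars split_rshift iA.
  by exists (t i); rewrite /colon_vars split_lshift iA.
rewrite /colon_vars; case: (split_ordP x) => i ->.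
  case/andP=> [/dom[j jA eij] mi]; left; exists i, j.
  by rewrite !mnmDE !set_mnm_t jA addn_eq0 negb_and mi orbT.
case/andP=> iA mi; right; exists i.
  by rewrite mnmDE set_mnm_t iA.
by rewrite mnmDE addn_eq0 negb_and mi orbT.
Qed.

Lemma v_degree_maxset A : (0 < s)%N -> maxset (stable_set e) A -> v_degree I #|A|.
Proof.
move=> s_gt0 mA; split.
  (* Degrees start at 1, so [A] must be nonempty: it contains the first vertex or a neighbour of
     it. *)
  rewrite card_gt0; apply/set0Pn.
  have [iA|iA] := boolP (Ordinal s_gt0 \in A); first by exists (Ordinal s_gt0).
  by have [j jA _] := maxset_stable_dominating e_sym e_irr mA iA; exists j.
exists 'X_[set_mnm A], (fun p => supp_in (var_dvd (colon_vars A)) p).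
have colonE g : colon I 'X_[set_mnm A] g <-> supp_in (var_dvd (colon_vars A)) g.
  rewrite /colon mulrC; apply: iff_trans (edge_idealP _ _) _.
  by rewrite in_monoXM /supp_in (eq_all (fun m => colon_set_mnm m mA)).
split=> //; first by rewrite dhomogX; apply/eqP/mdeg_set_mnm.
by split; [exact: prime_var_dvd | exists 'X_[set_mnm A]].
Qed.

(* Some monomial m of f is not in I.  The t_i dividing m form a stable set B;
   extend it to a maximal stable set A.  Since t_i u_i is in the prime (I : f),
   every i in A has t_i or u_i dividing m, so #|A| <= deg m = d. *)
Lemma v_degree_ge d : v_degree I d -> (indep_domination e <= d)%N.
Proof.
case=> _ [f [P [hf [[_ P1 Pprime] _] colonP]]].
have fnI : ~ I f by rewrite -[f]mul1r => /(colonP 1).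
have /allPn[m mf mE] : ~~ in_mono E f by apply/negP => /edge_idealP.
have colonX x : P 'X_x -> mdvd E (U_(x) + m)%MM.
  by move=> /colonP /edge_idealP; rewrite in_monoXM => /allP; apply.
pose B := [set i | m (t i) != 0%N].
have nadj i j : e i j -> m (t i) != 0%N -> m (t j) = 0%N.
  move=> eij mi; apply/eqP; apply: contraNT mE => mj.
  by apply/mdvd_whiskerP; left; exists i, j.
have tu0 i : m (t i) != 0%N -> m (u i) = 0%N.
  move=> mi; apply/eqP; apply: contraNT mE => mj.
  by apply/mdvd_whiskerP; right; exists i.
have stB : stable_set e B.
  apply/stable_setP => i j; rewrite !inE => mi mj.
  by apply/negP => /nadj/(_ mi) m0; rewrite m0 in mj.
have [A mA BA] := maxset_exists stB.
apply: leq_trans (indep_domination_le mA) _.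
have /maxsetP[/stable_setP sA _] := mA.
have cov i : i \in A -> (0 < m (t i) + m (u i))%N.
  move=> iA; rewrite lt0n addn_eq0 negb_and.
  have [//|/= mti] := boolP (m (t i) != 0%N).
  have /Pprime[/colonX|/colonX] : P ('X_(t i) * 'X_(u i)).
  - apply/colonP; rewrite /colon; apply/edge_idealP; rewrite mulrC.
    apply: in_monoMr; rewrite -mpolyXD; apply/in_monoX/mem_edge_mnms.
    by rewrite whisker_tu.
  - case/mdvd_whiskerP=> [[a [b [eab]]]|[a]]; rewrite !mnmDE !mnm1E !eq_shift.
      (* An edge dividing [t_i m] must use [t_i]. Its other end is no [t_j], as any [t_j] dividing
         [m] has [j] in the stable set [A]; so it is [u_i], which then divides [m]. *)
      have adj j : e i j -> m (t j) = 0%N.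
        move=> eij; apply/eqP; apply: contraTT (eij) => mj.
        by apply: sA => //; apply: (subsetP BA); rewrite inE.
      case: (eqVneq i a) => [ia _|_]; case: (eqVneq i b) => [ib|_].
      + by rewrite -ia -ib e_irr in eab.
      + by rewrite adj // ia.
      + by rewrite add0n (adj a) // ib e_sym.
      + by rewrite !add0n => /(nadj _ _ eab) ->.
    case: (eqVneq i a) => [->|_] //; rewrite !add0n => /tu0 -> //.
  (* If instead [u_i m] is in the ideal, the edge is [t_i u_i], contradicting that [t_i] does not
     divide [m]. *)
  case/mdvd_whiskerP=> [[a [b [eab]]]|[a]]; rewrite !mnmDE !mnm1E !eq_shift !add0n.
    by move=> /(nadj _ _ eab) ->.
  case: (eqVneq i a) => [<- mi|_ /tu0 ->] //.
  by rewrite mi in mti.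
have /dhomogP/(_ _ mf) <- := hf; rewrite [leqRHS]mdegE big_split_ord /= -big_split /=.
rewrite -sum1_card [leqLHS]big_mkcond; apply: leq_sum => i _.
by case: ifP => // /cov.
Qed.

(** As [A] is stable, every edge is some [t_i u_i] with [i] in [A] or contains a [t_j] with [j]
    outside [A]. So the edge ideal lies in the ideal of [fs ++ L], and [fs] has total degree
    [2 #|A|]. *)
Lemma shift_ge_stable A (F : min_free_res I) : stable_set e A ->
  exists a : 'I_(rk F #|A|), (#|A| + #|A|)%N%:Z <= shift a.
Proof.
move=> /stable_setP sA.
pose fs := [seq (U_(t i) + U_(u i))%MM : 'X_{1..s + s} | i <- enum A].
pose L := [seq U_(t i)%MM : 'X_{1..s + s} | i <- enum (~: A)].
have idI : is_ideal I.
  split=> [|p q /edge_idealP hp /edge_idealP hq|p q /edge_idealP hq]; apply/edge_idealP.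
  - exact: supp_in0.
  - exact: supp_inD.
  - exact: in_monoMr.
have szfs : size fs = #|A| by rewrite size_map -cardE.
have dgfs : (\sum_(f <- fs) mdeg f)%N = (#|A| + #|A|)%N.
  rewrite big_map big_enum /= -sum1_card -big_split /=; apply: eq_bigr => i _.
  by rewrite mdegD !mdeg1.
have := @shift_lower_bound _ _ _ F idI fs L; rewrite szfs dgfs; apply.
- move=> p /edge_idealP; apply: sub_all => m mE.
  have L_dvd k : k \notin A -> m (t k) != 0%N -> mdvd (fs ++ L) m.
    move=> kA mk; apply/hasP; exists U_(t k)%MM; last by rewrite lep1mP.
    by rewrite mem_cat (map_f (fun i => U_(t i)%MM)) ?orbT // mem_enum inE.
  case/mdvd_whiskerP: mE => [[i [j [eij mi mj]]]|[i mi mj]];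
    have [iA|iA] := boolP (i \in A); try exact: L_dvd mi.
    have [jA|jA] := boolP (j \in A); last exact: L_dvd mj.
    by have := sA _ _ iA jA; rewrite eij.
  apply/hasP; exists (U_(t i) + U_(u i))%MM.
    by rewrite mem_cat; apply/orP; left; apply/mapP; exists i; rewrite ?mem_enum.
  apply/mnm_lepP => x; rewrite mnmDE !mnm1E.
  by case: (split_ordP x) => k ->; rewrite !eq_shift ?addn0 ?add0n;
    case: (eqVneq i k) => // <-; rewrite lt0n.
- move=> _ /mapP[i _ ->]; apply/edge_idealP/in_monoX/mem_edge_mnms.
  by rewrite whisker_tu.
- rewrite pairwise_map; have := enum_uniq A; rewrite uniq_pairwise.
  apply: sub_pairwise => i j /= ij; apply/forallP => x; rewrite !mnmDE !mnm1E.
  case: (split_ordP x) => k ->; rewrite !eq_shift ?addn0 ?add0n;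
  by case: (eqVneq i k) => // <-; rewrite [j == i]eq_sym (negbTE ij).
- apply/allrelP => _ _ /mapP[i iA ->] /mapP[j jA ->].
  apply/forallP => x; rewrite mnmDE !mnm1E.
  case: (split_ordP x) => k ->; rewrite !eq_shift ?orbT // addn0.
  case: (eqVneq i k) => // <-; case: (eqVneq j i) => // ji.
  by move: iA jA; rewrite !mem_enum inE ji => ->.
rewrite mem_cat negb_or; apply/andP; split; apply/mapP => -[i _ /eqP].
  by rewrite eq_sym mnmD_eq0 mnm1_eq0.
by rewrite eq_sym mnm1_eq0.
Qed.

End WhiskerGraph.

(** * The v-number and its comparison with regularity *)

Theorem theorem3p20 (s : nat) (e : rel 'I_s) (K : fieldType)
    (s_gt0 : (0 < s)%N) (e_sym : ssrbool.symmetric e) (e_irr : irreflexive e) :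
  is_v_number (edge_ideal K (whisker e)) (indep_domination e) /\
  (forall (v : nat) (r : int),
     is_v_number (edge_ideal K (whisker e)) v ->
     is_regularity (edge_ideal K (whisker e)) r ->
     v%:Z <= r).
Proof.
have [A mA iA] := indep_domination_eq e.
have vA : v_degree (edge_ideal K (whisker e)) #|A| by apply: v_degree_maxset.
split=> [|v r [_ vmin] [F [_ rmax]]].
  by split=> [|d]; [rewrite iA | apply: v_degree_ge].
have /maxsetP[sA _] := mA.
(* A shift of at least [2 #|A|] in step [#|A|] forces regularity at least [#|A|], which is at least
   [v] by minimality of [v]. *)
have [a ha] := shift_ge_stable e_irr F sA.
have : betti F #|A| (shift a) != 0%N by rewrite -lt0n; apply/card_gt0P; exists a; rewrite inE.
move=> /rmax; apply: le_trans; apply: le_trans (_ : #|A|%:Z <= _).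
  by rewrite lez_nat vmin.
by rewrite lerBrDr -PoszD.
Qed.
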